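(* Let $X$ be a Cantor set and let $\mathcal{G}\subset\mathrm{Homeo}(X)$ be an ample group that acts minimally on $X$ and has Property E. Suppose $X=U_1\sqcup U_2\sqcup\dots\sqcup U_k$ is a partition of $X$ into $k\ge3$ nonempty clopen sets. Then the stabilizer $\mathrm{St}_{\mathcal{G}}(U_1,U_2,\dots,U_k)$ of the partition is a maximal subgroup of $\mathcal{G}$ if and only if its induced action on the set $\{U_1,U_2,\dots,U_k\}$ is transitive.
   Context: $\mathrm{Homeo}(X)$ is the group of all homeomorphisms of $X$. For a group $G\subset\mathrm{Homeo}(X)$, its full amplification $\mathsf{F}(G)$ is the group of all homeomorphisms $f$ of $X$ such that every point $x\in X$ has an open neighborhood $U_x$ on which $f$ coincides with some element of $G$. The group $G$ is called ample if $\mathsf{F}(G)=G$. A group acts minimally on $X$ if the only closed invariant subsets are $\emptyset$ and $X$. For a clopen (closed and open) set $U\subset X$, the local subgroup $\mathcal{G}_U$ consists of all $g\in\mathcal{G}$ such that $g(x)=x$ for all $x\notin U$. Property E for the ample group $\mathcal{G}$: for any clopen sets $V_1,V_2\subset X$ with $V_1\cap V_2\ne\emptyset$, the group $\mathcal{G}_{V_1\cup V_2}$ is generated by $\mathcal{G}_{V_1}\cup\mathcal{G}_{V_2}$. $\mathrm{St}_{\mathcal{G}}(U_1,\dots,U_k)$ consists of those $g\in\mathcal{G}$ that map each set $U_i$ onto some (the same or another) set $U_j$. A maximal subgroup of $\mathcal{G}$ is a proper subgroup $H$ such that there is no subgroup $K$ with $H\subsetneq K\subsetneq\mathcal{G}$.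 *)

(* Defs.v *)
From HB Require Import structures.
From mathcomp Require Import all_boot.
From mathcomp Require Import boolp classical_sets functions topology cantor.

Set Implicit Arguments.
Unset Strict Implicit.
Unset Printing Implicit Defensive.

Local Open Scope classical_set_scope.
Local Open Scope group_scope.

(* The library predicate [cantor_like] does not require metrizability (second
   countability) and is therefore too weak to characterize Cantor sets. *)
Definition cantor_set (X : topologicalType) : Prop :=
  exists (f : cantor_space -> X) (g : X -> cantor_space),
    [/\ cancel f g, cancel g f, continuous f & continuous g].

(* The inverse is part of the data, but it is determined by the underlying
   function: see [homeoP]. *)
Record homeo (X : topologicalType) := Homeo {
  homeo_fun :> X -> X;
  homeo_inv : X -> X;
  homeoK : cancel homeo_fun homeo_inv;
  homeo_invK : cancel homeo_inv homeo_fun;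
  homeo_continuous : continuous homeo_fun;
  homeo_inv_continuous : continuous homeo_inv
}.

Lemma homeoP (X : topologicalType) (f g : homeo X) : f =1 g -> f = g.
Proof.
case: f g => [f f' fK f'K cf cf'] [g g' gK g'K cg cg'] /= /funext fg.
subst g.
have fg' : f' = g' by apply/funext => x; rewrite -{1}(g'K x) fK.
subst g'; by congr Homeo; exact: Prop_irrelevance.
Qed.

HB.instance Definition _ (X : topologicalType) := gen_eqMixin (homeo X).
HB.instance Definition _ (X : topologicalType) := gen_choiceMixin (homeo X).

Section HomeoGroup.
Variable X : topologicalType.

Definition homeo_one : homeo X :=
  @Homeo X idfun idfun (fun=> erefl) (fun=> erefl)
    (fun x => @cvg_id _ (nbhs x)) (fun x => @cvg_id _ (nbhs x)).

Definition homeo_inverse (f : homeo X) : homeo X :=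
  Homeo (@homeo_invK X f) (@homeoK X f)
    (@homeo_inv_continuous X f) (@homeo_continuous X f).

Definition homeo_comp (f g : homeo X) : homeo X :=
  @Homeo X (f \o g) (homeo_inv g \o homeo_inv f)
    (can_comp (@homeoK X f) (@homeoK X g))
    (can_comp (@homeo_invK X g) (@homeo_invK X f))
    (fun x => continuous_comp (@homeo_continuous X g x)
                              (@homeo_continuous X f (g x)))
    (fun x => continuous_comp (@homeo_inv_continuous X f x)
                              (@homeo_inv_continuous X g (homeo_inv f x))).

Lemma homeo_compA : associative homeo_comp.
Proof. by move=> f g h; exact: homeoP. Qed.

Lemma homeo_comp1f : left_id homeo_one homeo_comp.
Proof. by move=> f; exact: homeoP. Qed.

Lemma homeo_compf1 : right_id homeo_one homeo_comp.
Proof. by move=> f; exact: homeoP. Qed.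

Lemma homeo_compVf : left_inverse homeo_one homeo_inverse homeo_comp.
Proof. by move=> f; apply: homeoP => x /=; rewrite homeoK. Qed.

Lemma homeo_compfV : right_inverse homeo_one homeo_inverse homeo_comp.
Proof. by move=> f; apply: homeoP => x /=; rewrite homeo_invK. Qed.

HB.instance Definition _ := isGroup.Build (homeo X)
  homeo_compA homeo_comp1f homeo_compf1 homeo_compVf homeo_compfV.

End HomeoGroup.

Section Subgroups.
Variable gT : groupType.
Implicit Types A G H K : set gT.

Definition subgroup H : Prop :=
  [/\ H 1, (forall f g, H f -> H g -> H (f * g)) & (forall f, H f -> H f^-1)].

Definition generated A : set gT := smallest subgroup A.

Definition maximal_subgroup G H : Prop :=
  [/\ subgroup H, H `<` G &
      ~ exists K, [/\ subgroup K, H `<` K & K `<` G]].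

End Subgroups.

Section Amplification.
Variable X : topologicalType.
Implicit Types (G H : set (homeo X)) (V : set X).

Definition full_amplification G : set (homeo X) :=
  [set f | forall x : X, exists V, [/\ open V, V x &
     exists2 g, G g & forall y, V y -> f y = g y]].

Definition ample G : Prop := full_amplification G = G.

Definition invariant_set G V : Prop := forall g, G g -> g @` V = V.

Definition acts_minimally G : Prop :=
  forall V, closed V -> invariant_set G V -> V = set0 \/ V = setT.

Definition local_subgroup G V : set (homeo X) :=
  [set g | G g /\ forall x, ~ V x -> g x = x].

Definition propertyE G : Prop :=
  forall V1 V2, clopen V1 -> clopen V2 -> V1 `&` V2 !=set0 ->
    local_subgroup G (V1 `|` V2) =
    generated (local_subgroup G V1 `|` local_subgroup G V2).

Definition family_stabilizer G (k : nat) (U : 'I_k -> set X) :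
    set (homeo X) :=
  [set g | G g /\ forall i, exists j, g @` U i = U j].

Definition transitive_on H (k : nat) (U : 'I_k -> set X) : Prop :=
  forall i j, exists2 h, H h & h @` U i = U j.

End Amplification.

(* Main.v *)
Require Import Defs.
From mathcomp Require Import all_boot.
From mathcomp Require Import boolp classical_sets functions topology cantor.

(** Ampleness makes every clopen exchange of [W] with a disjoint [g @` W] an
    involution of [G]. By minimality, [G] thus contains elements moving a small
    piece of one clopen set into another and fixing the rest.

    If the stabilizer is not transitive, let [V] be the union of an orbit of
    parts. The setwise stabilizer of [V] is a proper subgroup, and as [k >= 3]
    either [V] or its complement contains two parts, pieces of which can be
    exchanged: the stabilizer of the partition is not maximal.

    If it is transitive, then exchanges of whole parts show that it induces
    every transposition of the parts. For an overgroup [H], consider the clopen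
    sets [V] whose local subgroup lies in [H]: they are stable under [H], contain
    the parts, and by Property E are closed under union of two intersecting
    members. An element of [H] outside the stabilizer yields a member meeting
    two parts; transpositions then enlarge it to the whole space. *)

Local Open Scope classical_set_scope.

(** * Cantor sets: no isolated points, and separation by clopen sets *)

Lemma cantor_set_perfect (X : topologicalType) :
  cantor_set X -> perfect_set [set: X].
Proof.
case=> f [g [fK gK cf cg]]; apply/perfectTP => x ox.
have /perfectTP/(_ (g x)) := cantor_perfect; apply.
have -> : [set g x] = f @^-1` [set x].
  by apply/seteqP; split=> [z ->|z /= <-] /=; [exact: gK|rewrite fK].
by apply: open_comp => // z _; exact: cf.
Qed.

Lemma cantor_set_zero_dimensional (X : topologicalType) :
  cantor_set X -> zero_dimensional X.
Proof.
case=> f [g [fK gK cf cg]] x y xy.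
have [|C [clC Cx Cy]] := @cantor_zero_dimensional (g x) (g y).
  by apply: contra_neq xy => /(can_inj gK).
by exists (g @^-1` C); split => //; exact: preimage_clopen.
Qed.

(** * Images of sets under homeomorphisms *)

Lemma image_homeo (X : topologicalType) (g : homeo X) (V : set X) :
  g @` V = homeo_inv g @^-1` V.
Proof.
apply/seteqP; split=> [_ [x Vx <-] /=|x Vx]; first by rewrite homeoK.
by exists (homeo_inv g x) => //; rewrite homeo_invK.
Qed.

Lemma clopen_image_homeo (X : topologicalType) (g : homeo X) (V : set X) :
  clopen V -> clopen (g @` V).
Proof.
move=> clV; rewrite image_homeo; apply: preimage_clopen => //.
exact: homeo_inv_continuous.
Qed.

Lemma image_homeoM (X : topologicalType) (f g : homeo X) (V : set X) :
  (f * g)%g @` V = f @` (g @` V).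
Proof. by rewrite image_comp. Qed.

Lemma image_homeoV (X : topologicalType) (g : homeo X) (V W : set X) :
  g @` V = W -> (g^-1)%g @` W = V.
Proof.
move=> <-; apply/seteqP; split=> [_ [_ [x Vx <-] <-]|x Vx] /=.
  by rewrite homeoK.
by exists (g x); [exists x|rewrite /= homeoK].
Qed.

Lemma image_homeo_fix (X : topologicalType) (g : homeo X) (V : set X) :
  (forall x, V x -> g x = x) -> g @` V = V.
Proof.
move=> gV; apply/seteqP; split=> [_ [x Vx <-]|x Vx]; first by rewrite gV.
by exists x => //; exact: gV.
Qed.

Lemma image_homeo_supported (X : topologicalType) (g : homeo X) (V : set X) :
  (forall x, ~ V x -> g x = x) -> g @` V = V.
Proof.
move=> gV; apply/seteqP; split=> [_ [x Vx <-]|x Vx].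
  apply: contrapT => nVgx; have := gV _ nVgx.
  by move=> /(can_inj (homeoK g)) gxx; apply: nVgx; rewrite gxx.
exists (homeo_inv g x); last exact: homeo_invK.
apply: contrapT => nV; have := gV _ nV; rewrite homeo_invK => xE.
by apply: nV; rewrite -xE.
Qed.

(** * Gluing elements of an ample group *)

Lemma locally_eq_continuous (X : topologicalType) (f : X -> X) :
  (forall x, exists V, [/\ open V, V x &
     exists2 g : X -> X, continuous g & forall y, V y -> f y = g y]) ->
  continuous f.
Proof.
move=> fl x B; have [V [oV Vx [g cg fg]]] := fl x.
rewrite fg// => /(cg x) gB.
have Vn : nbhs x V by exact: open_nbhs_nbhs.
by apply: filterS (filterI Vn gB) => y [/fg fy gy]; rewrite /preimage /= fy.
Qed.

(** An involution is its own inverse, so its continuity, a local matter, already makes it a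
    homeomorphism. *)
Lemma ample_involution (X : topologicalType) (G : set (homeo X)) (f : X -> X) :
  ample G -> involutive f ->
  (forall x, exists V, [/\ open V, V x &
     exists2 g, G g & forall y, V y -> f y = g y]) ->
  exists2 s, G s & s =1 f.
Proof.
move=> aG fK fG; have cf : continuous f.
  apply: locally_eq_continuous => x; have [V [oV Vx [g _ fg]]] := fG x.
  exists V; split => //; exists g => //; exact: homeo_continuous.
by exists (Homeo fK fK cf cf) => //; rewrite -aG.
Qed.

(** Glue [g], its inverse and the identity along three clopen pieces; disjointness of [W] and its
    image makes the result an involution. *)
Lemma ample_swap (X : topologicalType) (G : set (homeo X)) (g : homeo X)
    (W : set X) :
  subgroup G -> ample G -> G g -> clopen W -> W `&` g @` W = set0 ->
  exists2 s, G s & [/\ forall x, W x -> s x = g x,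
    forall x, (g @` W) x -> s x = homeo_inv g x &
    forall x, ~ W x -> ~ (g @` W) x -> s x = x].
Proof.
move=> [G1 _ GV] aG Gg clW WgW.
have clgW := clopen_image_homeo _ g _ clW.
pose f x := if `[< W x >] then g x else
  if `[< (g @` W) x >] then homeo_inv g x else x.
have fW x : W x -> f x = g x by move=> Wx; rewrite /f asboolT.
have nW x : (g @` W) x -> ~ W x.
  by move=> gWx Wx; have : (W `&` g @` W) x by []; rewrite WgW.
have fgW x : (g @` W) x -> f x = homeo_inv g x.
  by move=> gWx; rewrite /f asboolF ?asboolT//; exact: nW.
have fC x : ~ W x -> ~ (g @` W) x -> f x = x by move=> ? ?; rewrite /f !asboolF.
have fK : involutive f.
  move=> x; have [Wx|nWx] := pselect (W x).
    by rewrite (fW _ Wx) fgW ?homeoK//; exists x.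
  have [gWx|ngWx] := pselect ((g @` W) x); last by rewrite !(fC _ nWx).
  by rewrite (fgW _ gWx) fW ?homeo_invK//; move: gWx; rewrite image_homeo.
have fl x : exists V, [/\ open V, V x &
    exists2 h, G h & forall y, V y -> f y = h y].
  have [Wx|nWx] := pselect (W x).
    by exists W; split => //; [exact: clW.1|exists g].
  have [gWx|ngWx] := pselect ((g @` W) x).
    exists (g @` W); split => //; first exact: clgW.1.
    by exists (g^-1)%g => //; exact: GV.
  exists (~` W `&` ~` (g @` W)); split => //.
    by apply: openI; apply: closed_openC; [exact: clW.2|exact: clgW.2].
  by exists 1%g => // y [? ?]; rewrite fC.
have [s Gs sf] := ample_involution _ _ _ aG fK fl.
by exists s => //; split=> x *; rewrite sf; [exact: fW|exact: fgW|exact: fC].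
Qed.

(** * Minimality and exchanges between clopen sets *)

Lemma minimal_orbit (X : topologicalType) (G : set (homeo X)) (x : X)
    (B : set X) :
  subgroup G -> acts_minimally G -> open B -> B !=set0 ->
  exists2 g, G g & B (g x).
Proof.
move=> [G1 GM GV] mG oB [b Bb]; apply: contrapT => nx.
(* The points whose orbit misses [B] form a closed invariant set. It would contain [x] but not [b],
   against minimality. *)
pose V := [set y | forall g, G g -> ~ B (g y)].
have clV : closed V.
  have -> : V = \bigcap_(g in G) (g @^-1` ~` B) by [].
  apply: closed_bigI => g _; apply: preimage_closed; last exact: open_closedC.
  by move=> z _; exact: homeo_continuous.
have GVsub g : G g -> g @` V `<=` V.
  move=> Gg _ [y Vy <-] h Gh; exact: Vy (h * g)%g (GM _ _ Gh Gg).
have invV : invariant_set G V.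
  move=> g Gg; apply/seteqP; split; first exact: GVsub.
  move=> y Vy; exists (homeo_inv g y); last exact: homeo_invK.
  by apply: (GVsub _ (GV _ Gg)); exists y.
case: (mG V clV invV) => VE.
  suff : V x by rewrite VE.
  by move=> g Gg Bgx; apply: nx; exists g.
have : V b by rewrite VE.
by move=> /(_ 1%g G1); exact.
Qed.

(** Exchanging only a piece of [A] leaves another point of [A] in [A]; an image of [A] split in this
    way cannot be a part of a partition containing [A] and [B]. *)
Lemma partial_swap (X : topologicalType) (G : set (homeo X)) (A B : set X) :
  cantor_set X -> subgroup G -> ample G -> acts_minimally G ->
  clopen A -> clopen B -> A !=set0 -> B !=set0 -> A `&` B = set0 ->
  exists2 s, G s & [/\ exists2 x, A x & B (s x), exists2 y, A y & A (s y) &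
    forall z, ~ A z -> ~ B z -> s z = z].
Proof.
move=> cX sG aG mG clA clB A0 B0 AB.
(* The set [C] separates two points of [A], so that the exchanged piece [W] contains [x] while [y]
   stays fixed. *)
have /perfectTP_ex/(_ _ clA.1 A0)[x [y [Ax Ay xy]]] := cantor_set_perfect _ cX.
have [C [clC Cx Cy]] := cantor_set_zero_dimensional _ cX _ _ xy.
have [g Gg Bgx] := minimal_orbit _ _ x _ sG mG clB.1 B0.
pose W := A `&` (g @^-1` B) `&` C.
have clW : clopen W.
  have clgB : clopen (g @^-1` B).
    by apply: preimage_clopen => //; exact: homeo_continuous.
  split.
    apply: openI; last exact: clC.1.
    by apply: openI; [exact: clA.1|exact: clgB.1].
  apply: closedI; last exact: clC.2.
  by apply: closedI; [exact: clA.2|exact: clgB.2].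
have gWB z : (g @` W) z -> B z by move=> [w [[_ +] _] <-].
have nAB z : A z -> ~ B z.
  by move=> Az Bz; have : (A `&` B) z by []; rewrite AB.
have WgW : W `&` g @` W = set0.
  by apply/seteqP; split=> // z [[[Az _] _] /gWB]; exact: nAB.
have [s Gs [sW sgW sC]] := ample_swap _ _ _ _ sG aG Gg clW WgW.
exists s => //; split.
- by exists x => //; rewrite sW.
- exists y => //; rewrite sC//; first by move=> [].
  by move=> /gWB; exact: nAB.
- by move=> z nAz nBz; apply: sC; [move=> [[]]|move=> /gWB].
Qed.

Lemma full_swap (X : topologicalType) (G : set (homeo X)) (g : homeo X)
    (A B : set X) :
  subgroup G -> ample G -> G g -> clopen A -> g @` A = B -> A `&` B = set0 ->
  exists2 s, G s & [/\ s @` A = B, s @` B = A &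
    forall z, ~ A z -> ~ B z -> s z = z].
Proof.
move=> sG aG Gg clA <- AB.
have [s Gs [sA sgA sC]] := ample_swap _ _ _ _ sG aG Gg clA AB.
exists s => //; split => //; apply/seteqP; split.
- by move=> _ [x Ax <-]; exists x => //; rewrite sA.
- by move=> _ [x Ax <-]; exists x => //; rewrite sA.
- by move=> _ [_ [x Ax <-] <-]; rewrite sgA ?homeoK//; exists x.
- by move=> x Ax; exists (g x); [exists x|rewrite sgA ?homeoK//; exists x].
Qed.

(** * Clopen partitions and their stabilizers *)

Lemma partition_eq (X : Type) (I : Type) (U : I -> set X) (i j : I) (x : X) :
  partition [set: I] U [set: X] -> U i x -> U j x -> i = j.
Proof. by move=> [_ tU _] Uix Ujx; apply: tU => //; exists x. Qed.

Lemma partition_cover (X : Type) (I : Type) (U : I -> set X) (x : X) :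
  partition [set: I] U [set: X] -> exists i, U i x.
Proof.
by move=> [cU _ _]; have : [set: X] x by []; rewrite -cU => -[i _]; exists i.
Qed.

Lemma partition_bigcup_clopen (X : topologicalType) (I : Type)
    (U : I -> set X) (D : set I) :
  partition [set: I] U [set: X] -> (forall i, clopen (U i)) ->
  clopen (\bigcup_(i in D) U i).
Proof.
move=> pU clU; have oU E : open (\bigcup_(i in E) U i).
  by apply: bigcup_open => i _; exact: (clU i).1.
split=> //; rewrite -openC.
have -> : ~` (\bigcup_(i in D) U i) = \bigcup_(i in ~` D) U i; last exact: oU.
apply/seteqP; split=> [x nx|x [i nDi Uix] [j Dj Ujx]].
  have [i Uix] := partition_cover _ _ _ x pU.
  by exists i => // Di; apply: nx; exists i.
by apply: nDi; rewrite (partition_eq _ _ _ _ _ _ pU Uix Ujx).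
Qed.

Lemma family_stabilizer_subgroup (X : topologicalType) (G : set (homeo X))
    (k : nat) (U : 'I_k -> set X) :
  subgroup G -> partition [set: 'I_k] U [set: X] ->
  subgroup (family_stabilizer G U).
Proof.
move=> [G1 GM GV] pU; split.
- split=> // i; exists i; exact: image_homeo_fix.
- move=> f g [Gf fU] [Gg gU]; split; first exact: GM.
  move=> i; have [j gj] := gU i; have [l fl] := fU j.
  by exists l; rewrite image_homeoM gj.
- move=> g [Gg gU]; split; first exact: GV.
  (* To find the part that [g] maps onto [U i], pull back a point [x] of [U i]: the image of the
     part reached is a part containing [x], hence [U i]. *)
  move=> i; have [x Uix] : U i !=set0 by case: pU => _ _; apply.
  have [j Ujx] := partition_cover _ _ _ (homeo_inv g x) pU.
  have [l gl] := gU j; exists j; apply: image_homeoV; rewrite gl.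
  suff -> : l = i by [].
  by apply: (partition_eq _ _ _ _ _ x pU) => //; rewrite -gl image_homeo.
Qed.

Lemma family_stabilizer_not_split (X : topologicalType) (G : set (homeo X))
    (k : nat) (U : 'I_k -> set X) (s : homeo X) (i j : 'I_k) (x y : X) :
  partition [set: 'I_k] U [set: X] -> i != j ->
  U i x -> U j (s x) -> U i y -> U i (s y) -> ~ family_stabilizer G U s.
Proof.
move=> pU ij Uix Ujsx Uiy Uisy [_ /(_ i)[l sl]].
have Ulx : U l (s x) by rewrite -sl; exists x.
have Uly : U l (s y) by rewrite -sl; exists y.
move/eqP: ij; apply.
rewrite (partition_eq _ _ _ _ _ _ pU Uisy Uly).
exact: partition_eq pU Ulx Ujsx.
Qed.

(** * Clopen sets whose local subgroup lies in an overgroup *)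

Lemma local_subgroupU (X : topologicalType) (G H : set (homeo X))
    (V W : set X) :
  propertyE G -> subgroup H -> clopen V -> clopen W -> V `&` W !=set0 ->
  local_subgroup G V `<=` H -> local_subgroup G W `<=` H ->
  local_subgroup G (V `|` W) `<=` H.
Proof.
move=> EG sH clV clW VW VH WH; rewrite EG//.
by apply: smallest_sub => // g [/VH|/WH].
Qed.

(** Conjugation by [h] carries the local subgroup of [V] to that of its image. *)
Lemma local_subgroup_image (X : topologicalType) (G H : set (homeo X))
    (h : homeo X) (V : set X) :
  subgroup G -> subgroup H -> H `<=` G -> H h ->
  local_subgroup G V `<=` H -> local_subgroup G (h @` V) `<=` H.
Proof.
move=> [G1 GM GV] [H1 HM HV] HG Hh VH g [Gg gV].
have Gh := HG _ Hh.
have Hc : H (h^-1 * g * h)%g.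
  apply: VH; split; first exact: GM (GM _ _ (GV _ Gh) Gg) Gh.
  move=> x nVx /=; rewrite gV ?homeoK// => -[y Vy /(can_inj (homeoK h))].
  by move=> yx; apply: nVx; rewrite -yx.
have -> : g = (h * (h^-1 * g * h) * h^-1)%g.
  rewrite !monoid.mulgA monoid.mulgV monoid.mul1g.
  by rewrite -monoid.mulgA monoid.mulgV monoid.mulg1.
exact: HM (HM _ _ Hh Hc) (HV _ Hh).
Qed.

Lemma local_subgroup_stabilizer (X : topologicalType) (G : set (homeo X))
    (k : nat) (U : 'I_k -> set X) (i : 'I_k) :
  partition [set: 'I_k] U [set: X] ->
  local_subgroup G (U i) `<=` family_stabilizer G U.
Proof.
move=> pU g [Gg gU]; split=> // j; exists j.
have [->|/eqP ij] := eqVneq j i; first exact: image_homeo_supported.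
apply: image_homeo_fix => x Ujx; apply: gU => Uix.
exact/ij/(partition_eq _ _ _ _ _ _ pU Ujx Uix).
Qed.

(** Transitivity supplies some [h] taking [U i] onto [U j]; only its restriction to [U i] enters the
    exchange, so the other parts stay fixed pointwise. *)
Lemma stabilizer_transposition (X : topologicalType) (G : set (homeo X))
    (k : nat) (U : 'I_k -> set X) (i j : 'I_k) :
  subgroup G -> ample G -> partition [set: 'I_k] U [set: X] ->
  (forall i, clopen (U i)) -> transitive_on (family_stabilizer G U) U ->
  i != j ->
  exists2 s, family_stabilizer G U s & s @` U i = U j /\
    forall l, l != i -> l != j -> forall x, U l x -> s x = x.
Proof.
move=> sG aG pU clU tr ij; have [h [Gh _] hij] := tr i j.
have Uij : U i `&` U j = set0 by case: pU => _ /trivIsetP tU _; exact: tU.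
have [s Gs [sij sji sC]] := full_swap _ _ _ _ _ sG aG Gh (clU i) hij Uij.
have sl l : l != i -> l != j -> forall x, U l x -> s x = x.
  move=> /eqP li /eqP lj x Ulx; apply: sC => Ux.
    exact/li/(partition_eq _ _ _ _ _ _ pU Ulx Ux).
  exact/lj/(partition_eq _ _ _ _ _ _ pU Ulx Ux).
exists s => //; split=> // l.
have [->|li] := eqVneq l i; first by exists j.
have [->|lj] := eqVneq l j; first by exists i.
by exists l; apply: image_homeo_fix; exact: sl.
Qed.

Lemma overgroup_local_subgroup_split (X : topologicalType)
    (G H : set (homeo X)) (k : nat) (U : 'I_k -> set X) :
  subgroup G -> partition [set: 'I_k] U [set: X] ->
  (forall i, clopen (U i)) -> subgroup H -> H `<=` G ->
  family_stabilizer G U `<` H ->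
  exists V a b, [/\ clopen V, local_subgroup G V `<=` H, a != b,
    U a `&` V !=set0 & U b `&` V !=set0].
Proof.
move=> sG pU clU sH HG [StH /nonsubset[h [Hh nSth]]].
have UH i : local_subgroup G (U i) `<=` H.
  exact: subset_trans (local_subgroup_stabilizer _ _ _ _ _ pU) StH.
have [i hi] : exists i, forall j, h @` U i <> U j.
  apply: contrapT => nh; apply: nSth; split; first exact: HG.
  move=> i; apply: contrapT => ni; apply: nh.
  by exists i => j hj; apply: ni; exists j.
have [x Uix] : U i !=set0 by case: pU => _ _; apply.
have [j Ujhx] := partition_cover _ _ _ (h x) pU.
have neq l m y : U l y -> ~ U m y -> m != l.
  by move=> Uly nUmy; apply/eqP => lm; apply: nUmy; rewrite lm.
have [hij|/nonsubset[y [hUy nUjy]]] := pselect (h @` U i `<=` U j).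
  have [z [Ujz nhz]] : U j `&` ~` (h @` U i) !=set0.
    by apply: nonsubset => jhi; apply: (hi j); apply/seteqP.
  have [b Ubz] := partition_cover _ _ _ (homeo_inv h z) pU.
  exists ((h^-1)%g @` U j), i, b; split.
  - exact: clopen_image_homeo.
  - by apply: local_subgroup_image => //; case: sH => _ _; apply.
  - by apply: neq Ubz _ => Uiz; apply: nhz; rewrite image_homeo.
  - by exists x; split=> //; exists (h x) => //=; rewrite homeoK.
  - by exists (homeo_inv h z); split=> //; exists z.
have [b Uby] := partition_cover _ _ _ y pU.
exists (h @` U i), j, b; split.
- exact: clopen_image_homeo.
- exact: local_subgroup_image.
- exact: neq Uby nUjy.
- by exists (h x); split=> //; exists x.
- by exists y.
Qed.

Lemma stabilizer_overgroup_full (X : topologicalType) (G H : set (homeo X))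
    (k : nat) (U : 'I_k -> set X) :
  subgroup G -> ample G -> propertyE G ->
  partition [set: 'I_k] U [set: X] -> (forall i, clopen (U i)) ->
  transitive_on (family_stabilizer G U) U ->
  subgroup H -> H `<=` G -> family_stabilizer G U `<` H -> G `<=` H.
Proof.
move=> sG aG EG pU clU tr sH HG StH.
have [V [a [b [clV VH ab aV bV]]]] :=
  overgroup_local_subgroup_split _ _ _ _ _ sG pU clU sH HG StH.
(* Finite index sets make a maximal choice of [S] available; the empty set, for which [D] is [V],
   starts it. *)
pose D (S : {set 'I_k}) := V `|` \bigcup_(i in [set` S]) U i.
have clD S : clopen (D S).
  have clS := partition_bigcup_clopen _ _ _ [set` S] pU clU.
  by split; [apply: openU; [exact: clV.1|exact: clS.1]
            |apply: closedU; [exact: clV.2|exact: clS.2]].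
have DU S j : D (j |: S)%SET = D S `|` U j.
  rewrite /D -setUA; congr (_ `|` _); apply/seteqP; split=> x.
    move=> [i /=]; rewrite in_setU1 => /orP[/eqP->|iS] Ux; first by right.
    by left; exists i.
  move=> [[i /= iS Ux]|Ux]; [exists i|exists j] => //=;
    by rewrite in_setU1 ?iS ?orbT ?eqxx.
pose P (S : {set 'I_k}) := `[< local_subgroup G (D S) `<=` H >].
have P0 : P finset.set0.
  apply/asboolP; rewrite /D bigcup0 ?setU0// => i /=.
  by rewrite finset.in_set0.
have [S maxS _] := maxset_exists P0.
have /asboolP SH := maxsetp maxS.
have maxP j : P (j |: S)%SET -> j \in S.
  move=> Pj; rewrite -(maxsetsup maxS Pj) ?setU11//; exact: finset.subsetUr.
(* By Property E a part meeting [D S] can be added to it, so maximality puts its index in [S]. Hence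
   [D S] is exactly the union of the parts indexed by [S]. *)
have absorb j : U j `&` D S !=set0 -> j \in S.
  move=> [x [Ujx DSx]]; apply: maxP; apply/asboolP; rewrite DU.
  apply: local_subgroupU => //; first by exists x.
  exact: subset_trans (local_subgroup_stabilizer _ _ _ _ _ pU) StH.1.
have [aS bS] : a \in S /\ b \in S.
  by split; apply: absorb; [case: aV|case: bV] => x [Ux Vx]; exists x; split=> //; left.
have DSE x : D S x -> exists2 i, i \in S & U i x.
  move=> DSx; have [i Uix] := partition_cover _ _ _ x pU.
  by exists i => //; apply: absorb; exists x.
have UD i : i \in S -> U i `<=` D S by move=> iS x Uix; right; exists i.
have allS j : j \in S.
  apply: contrapT => /negP jS; have /negP := jS; apply; apply: maxP.
  have neqj i : i \in S -> i != j by move=> iS; apply: contraNneq jS => <-.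
  (* Transposing [U a] and [U j] turns [D S] into a set that still contains [U b]. The two sets thus
     intersect, and their union adds exactly [U j] to [D S]. *)
  have [s Sts [saj sfix]] :=
    stabilizer_transposition _ _ _ _ _ _ sG aG pU clU tr (neqj _ aS).
  have ba : b != a by rewrite eq_sym.
  have DjE : D (j |: S)%SET = D S `|` s @` D S.
    rewrite DU; apply/seteqP; split=> x [DSx|]; [by left| |by left|].
    - by rewrite -saj => -[y Uay <-]; right; exists y => //; exact: UD Uay.
    - move=> [y /DSE[i iS Uiy] <-].
      have [iE|ia] := eqVneq i a.
        by right; rewrite -saj; exists y => //; rewrite -iE.
      by left; rewrite (sfix i)//; [exact: UD Uiy|exact: neqj].
  apply/asboolP; rewrite DjE; apply: local_subgroupU => //.
  - exact: clopen_image_homeo.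
  - have [x Ubx] : U b !=set0 by case: pU => _ _; apply.
    exists x; split; first exact: UD Ubx.
    by exists x; [exact: UD Ubx|apply: (sfix b) => //; exact: neqj].
  - by apply: local_subgroup_image => //; exact: StH.1.
move=> g Gg; apply: SH; split=> // x nDx; exfalso; apply: nDx.
by have [i Uix] := partition_cover _ _ _ x pU; exact: UD Uix.
Qed.

(** * Maximality forces transitivity *)

Lemma maximal_stabilizer_transitive (X : topologicalType) (G : set (homeo X))
    (k : nat) (U : 'I_k -> set X) :
  cantor_set X -> subgroup G -> ample G -> acts_minimally G -> (3 <= k)%N ->
  partition [set: 'I_k] U [set: X] -> (forall i, clopen (U i)) ->
  maximal_subgroup G (family_stabilizer G U) ->
  transitive_on (family_stabilizer G U) U.
Proof.
move=> cX sG aG mG k3 pU clU [_ _ noK] i0 j0; apply: contrapT => nij.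
have [St1 StM StV] := family_stabilizer_subgroup _ _ _ _ sG pU.
have [G1 GM GV] := sG.
pose I := [set i | exists2 h, family_stabilizer G U h & h @` U i0 = U i].
pose V := \bigcup_(i in I) U i.
have Ii0 : I i0 by exists 1%g => //; exact: image_homeo_fix.
have U0 i : U i !=set0 by case: pU => _ _; apply.
have VI x i : U i x -> V x -> I i.
  by move=> Uix [j Ij Ujx]; rewrite (partition_eq _ _ _ _ _ _ pU Uix Ujx).
have swap i j : i != j -> exists2 s, G s & [/\ exists2 x, U i x & U j (s x),
    ~ family_stabilizer G U s & forall z, ~ U i z -> ~ U j z -> s z = z].
  move=> ij; have Uij : U i `&` U j = set0.
    by case: pU => _ /trivIsetP tU _; exact: tU.
  have [s Gs [[x Uix Ujx] [y Uiy Uisy] sC]] :=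
    partial_swap _ _ _ _ cX sG aG mG (clU i) (clU j) (U0 i) (U0 j) Uij.
  exists s => //; split=> //; first by exists x.
  exact: family_stabilizer_not_split pU ij Uix Ujx Uiy Uisy.
have ij0 : i0 != j0 by apply/eqP => ij; apply: nij; rewrite -ij.
(* The intermediate subgroup is the setwise stabilizer of [V], the union of the orbit of [U i0]. *)
apply: noK; exists [set g | G g /\ g @` V = V]; split.
- split.
  + by split=> //; exact: image_homeo_fix.
  + by move=> f g [Gf fV] [Gg gV]; split; [exact: GM|rewrite image_homeoM gV].
  + by move=> g [Gg gV]; split; [exact: GV|exact: image_homeoV].
- split.
    have StVsub g : family_stabilizer G U g -> g @` V `<=` V.
      move=> Stg _ [x [i [h Sth hi] Uix] <-].
      have [j gj] := Stg.2 i; exists j; last by rewrite -gj; exists x.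
      by exists (g * h)%g; [exact: StM|rewrite image_homeoM hi].
    move=> g Stg; split; first exact: Stg.1.
    apply/seteqP; split; first exact: StVsub.
    move=> x Vx; exists (homeo_inv g x); last exact: homeo_invK.
    by apply: (StVsub _ (StV _ Stg)); exists x.
  (* A third index exists as [k >= 3]. If [l] is in the orbit, [U l] and [U i0] lie in [V];
     otherwise [U l] and [U j0] both avoid [V]. Exchanging pieces of these two parts preserves [V]
     but not the partition. *)
  have [l li lj] : exists2 l, l != i0 & l != j0.
    have /card_gt0P[l] : (0 < #|~: [set i0; j0]%SET|)%N.
      by have := cardsC [set i0; j0]%SET; rewrite cards2 ij0 card_ord => kE;
        rewrite -(ltn_add2l 2) kE.
    by rewrite !inE negb_or => /andP[li lj]; exists l.
  move=> KSt; have [Il|nIl] := pselect (I l).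
    have [s Gs [_ nSts sC]] := swap _ _ li.
    apply: nSts; apply: KSt; split=> //.
    apply: image_homeo_supported => x nVx; apply: sC => Ux; apply: nVx.
      by exists l.
    by exists i0.
  have [s Gs [_ nSts sC]] := swap _ _ lj.
  apply: nSts; apply: KSt; split=> //.
  apply: image_homeo_fix => x Vx; apply: sC => /VI/(_ Vx)//.
- split=> [g []//|GK].
  (* A piece of [U i0] moved into [U j0] leaves [V], so the setwise stabilizer is proper. *)
  have [s Gs [[x Ui0x Uj0x] _ _]] := swap _ _ ij0.
  have [_ sV] := GK _ Gs; apply: nij; apply: VI Uj0x _.
  by rewrite -sV; exists x => //; exists i0.
Qed.

(** * The equivalence, with properness of the stabilizer *)

Theorem theorem1p5 (X : topologicalType) (G : set (homeo X))
    (k : nat) (U : 'I_k -> set X) :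
  cantor_set X ->
  subgroup G ->
  ample G ->
  acts_minimally G ->
  propertyE G ->
  (3 <= k)%N ->
  partition [set: 'I_k] U [set: X] ->
  (forall i, clopen (U i)) ->
  maximal_subgroup G (family_stabilizer G U) <->
  transitive_on (family_stabilizer G U) U.
Proof.
move=> cX sG aG mG EG k3 pU clU; split.
  exact: maximal_stabilizer_transitive.
move=> tr; split; first exact: family_stabilizer_subgroup.
- split=> [g []//|GSt].
  have U0 i : U i !=set0 by case: pU => _ _; apply.
  (* Since [k3] reads [2 < k], the two distinct indices are 0 and 2. *)
  pose i := Ordinal (ltn_trans (ltn0Sn 1) k3).
  pose j := Ordinal k3.
  have Uij : U i `&` U j = set0 by case: pU => _ /trivIsetP tU _; exact: tU.
  have [s Gs [[x Uix Ujx] [y Uiy Uisy] _]] :=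
    partial_swap _ _ _ _ cX sG aG mG (clU i) (clU j) (U0 i) (U0 j) Uij.
  have ij : i != j by [].
  exact: family_stabilizer_not_split pU ij Uix Ujx Uiy Uisy (GSt _ Gs).
- move=> [H [sH StH HG]]; apply: HG.2.
  by apply: stabilizer_overgroup_full StH => //; exact: HG.1.
Qed.
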